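(* Let $2\le p<\infty$, $\sigma\in(1,2]$, let $Q\subset\mathbb{R}^n$ be a compact convex set whose interior is nonempty and contains zero, and let $\|\cdot\|$ be a norm on $\mathbb{R}^n$. Let $f\in\mathcal{F}^{\sigma}_{\|\cdot\|}(Q,L_\sigma)$ and let $\Psi:Q\to\mathbb{R}$ be $p$-uniformly convex with respect to $\|\cdot\|$. Then for any $\varepsilon>0$, setting $\delta=\varepsilon/T$ and taking $M$ satisfying $$M\ge\left[\frac2p\left(\frac{p-\sigma}{\sigma}\right)\frac1\delta\right]^{\frac{p-\sigma}{\sigma}}L_\sigma^{\frac p\sigma},$$ the accelerated method with Bregman prox described in the context, started at $x_0\in Q$, guarantees an accuracy $$f(y_T)-f(y^* )\le\frac{D_\Psi(Q)}{A_T}+\frac{\varepsilon}{2}$$ after $T$ iterations, where $y^*$ is a minimizer of $f$ over $Q$.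
   Context: Hölder class: $\mathcal{F}^{\sigma}_{\|\cdot\|}(Q,L_\sigma)$ is the set of convex functions $f:Q\to\mathbb{R}$ with $\|\nabla f(x)-\nabla f(y)\|_*\le L_\sigma\|x-y\|^{\sigma-1}$ for all $x,y\in Q$, where $\|\cdot\|_*$ is the dual norm. Uniform convexity: a subdifferentiable function $\Psi:Q\to\mathbb{R}$ is $p$-uniformly convex with constant $\mu>0$ w.r.t. $\|\cdot\|$ if $\Psi(y)\ge\Psi(x)+\langle\nabla\Psi(x),y-x\rangle+\frac{\mu}{p}\|y-x\|^p$ for all $x$ in the interior of $Q$ and all $y\in Q$. When the constant is not mentioned, $\mu=1$. Here $\nabla\Psi(x)$ denotes a subgradient of $\Psi$ at $x$. Constant of variation: $D_\Psi(Q)=\sup_{x\in Q}\Psi(x)-\inf_{x\in Q}\Psi(x)$. Bregman divergence: $V_x(y)=\Psi(y)-\langle\nabla\Psi(x),y-x\rangle-\Psi(x)$ for $x$ in the interior of $Q$ and $y\in Q$. Step sequence: $\gamma_1=1$ and, for $t\ge1$, $\gamma_{t+1}$ is the largest root of $\gamma_{t+1}^p=\gamma_{t+1}^{p-1}+\gamma_t^p$. Accelerated method with Bregman prox (input $x_0\in Q$; parameters $M$, $T$): set $y_0=x_0$, $z_0=x_0$, $A_0=0$. For $t=0,\ldots,T-1$: set $\alpha_{t+1}=\gamma_{t+1}^{p-1}/M$, $A_{t+1}=A_t+\alpha_{t+1}$, $\tau_t=\alpha_{t+1}/A_{t+1}$, $x_{t+1}=\tau_tz_t+(1-\tau_t)y_t$,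 obtain $\nabla f(x_{t+1})$, and update $$y_{t+1}=\arg\min_{y\in Q}\left\{\tfrac Mp\|y-x_{t+1}\|^p+\langle\nabla f(x_{t+1}),y-x_{t+1}\rangle\right\},$$ $$z_{t+1}=\arg\min_{z\in Q}\left\{V_{z_t}(z)+\alpha_{t+1}\langle\nabla f(x_{t+1}),z-z_t\rangle\right\}.$$ The output is $y_T$.
   Formalization: x_0 is taken to be a minimizer of Ψ over Q (for arbitrary x_0 the bound fails), and where Ψ has several subgradients, ∇Ψ(x_0) and ∇Ψ(z_{t+1}) are ones satisfying the first-order optimality conditions (arbitrary choices break the bound); also M>0, T≥1. *)

(* Defs.v *)
From HB Require Import structures.
From mathcomp Require Import all_boot all_order all_algebra.
From mathcomp Require Import all_classical all_reals all_analysis.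
Set Implicit Arguments.
Unset Strict Implicit.
Unset Printing Implicit Defensive.
Import Order.TTheory GRing.Theory Num.Theory.
Import numFieldNormedType.Exports.
Local Open Scope classical_set_scope.
Local Open Scope ring_scope.

(* Functions on a set Q are represented by total functions on 'rV[R]_n whose
   values outside Q are never used. The topology of 'rV[R]_n is the library's
   (that of the sup norm); it coincides with the topology of any norm N below. *)

Section Definitions.
Context {R : realType} {n : nat}.
Local Notation V := 'rV[R]_n.
Implicit Types (N Psi f : V -> R) (Q : set V) (x y z g s u v : V).

Definition dot u v : R := \sum_(i < n) u 0 i * v 0 i.

Record is_norm N : Prop := {
  norm_triangle : forall u v, N (u + v) <= N u + N v;
  norm_scale : forall (a : R) v, N (a *: v) = `|a| * N v;
  norm_definite : forall v, N v = 0 -> v = 0 }.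

Definition dual_norm N g : R := sup [set dot g v | v in [set v | N v <= 1]].

Definition argmin_on Q (F : V -> R) x := Q x /\ forall v, Q v -> F x <= F v.

(* Frechet gradient of f relative to Q: at interior points of Q it is the usual
   gradient, and it also makes sense at boundary points, where the method may
   query it; it is unique when Q is convex with nonempty interior. *)
Definition is_gradient_on Q f (gradf : V -> V) := forall x, Q x ->
  forall e : R, 0 < e ->
    \forall y \near within Q (nbhs x),
      `|f y - f x - dot (gradf x) (y - x)| <= e * `|y - x|.

Definition holder_class N Q (sigma L : R) f (gradf : V -> V) :=
  [/\ convex_function Q f,
      is_gradient_on Q f gradf
    & forall x y, Q x -> Q y ->
        dual_norm N (gradf x - gradf y) <= L * N (x - y) `^ (sigma - 1)].

Definition is_subgradient Q Psi x g :=
  forall y, Q y -> Psi x + dot g (y - x) <= Psi y.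

Definition uniformly_convex N Q Psi (p mu : R) :=
  forall x, interior Q x ->
    exists2 g, is_subgradient Q Psi x g
      & forall y, Q y ->
          Psi x + dot g (y - x) + mu / p * N (y - x) `^ p <= Psi y.

(* Extended-real valued: nothing forces Psi to be bounded above on Q. *)
Definition const_variation Q Psi : \bar R :=
  (ereal_sup [set (Psi x)%:E | x in Q] - ereal_inf [set (Psi x)%:E | x in Q])%E.

(* Bregman divergence from x to y, where s stands for the subgradient of Psi
   at x that is denoted by nabla Psi(x). *)
Definition bregman Psi s x y : R := Psi y - dot s (y - x) - Psi x.

Definition step_sequence (p : R) (gamma : nat -> R) :=
  gamma 1%N = 1 /\
  forall t, (0 < t)%N ->
    let roots := [set r | 0 <= r /\ r `^ p = r `^ (p - 1) + gamma t `^ p] in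
    roots (gamma t.+1) /\ ubound roots (gamma t.+1).

Definition alpha (p M : R) (gamma : nat -> R) (t : nat) : R :=
  gamma t `^ (p - 1) / M.

Definition Asum (p M : R) (gamma : nat -> R) (t : nat) : R :=
  \sum_(i < t) alpha p M gamma i.+1.

Definition tau (p M : R) (gamma : nat -> R) (t : nat) : R :=
  alpha p M gamma t.+1 / Asum p M gamma t.+1.

(* x0 minimizes Psi over Q, and the subgradient s0 chosen at x0 is one that
   witnesses it in the first-order optimality condition. If Psi is
   differentiable at an interior x0, the second clause follows from the first. *)
Definition prox_center Q Psi x0 s0 :=
  argmin_on Q Psi x0 /\ forall u, Q u -> 0 <= dot s0 (u - x0).

(* T steps of the method. The sequence s records nabla Psi(z_t), needed for
   t < T only; z_t may lie on the boundary of Q, so s_t is a subgradient of Psi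
   relative to Q. When Psi has several subgradients at z_{t+1}, s_{t+1} is one
   that occurs in the first-order optimality condition of the problem defining
   z_{t+1} (s_t - alpha_{t+1} nabla f(x_{t+1}) always is); when the subgradient
   at z_{t+1} is unique, run_s_opt follows from run_z and run_s. *)
Record accelerated_run N Q (gradf : V -> V) Psi (p M : R) (gamma : nat -> R)
    (T : nat) (x0 : V) (x y z s : nat -> V) : Prop := {
  run_y0 : y 0%N = x0;
  run_z0 : z 0%N = x0;
  run_x : forall t, (t < T)%N ->
    x t.+1 = tau p M gamma t *: z t + (1 - tau p M gamma t) *: y t;
  run_y : forall t, (t < T)%N ->
    argmin_on Q (fun v => M / p * N (v - x t.+1) `^ p
                          + dot (gradf (x t.+1)) (v - x t.+1)) (y t.+1);
  run_z : forall t, (t < T)%N ->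
    argmin_on Q (fun v => bregman Psi (s t) (z t) v
                          + alpha p M gamma t.+1
                            * dot (gradf (x t.+1)) (v - z t)) (z t.+1);
  run_s : forall t, (t < T)%N -> is_subgradient Q Psi (z t) (s t);
  run_s_opt : forall t, (t.+1 < T)%N -> forall u, Q u ->
    0 <= dot (s t.+1 - s t + alpha p M gamma t.+1 *: gradf (x t.+1))
             (u - z t.+1) }.

End Definitions.

(* Main.v *)
Require Import Defs.
From mathcomp Require Import all_boot all_order all_algebra.
From mathcomp Require Import all_classical all_reals all_analysis.
From mathcomp Require Import ring lra.
Import Order.TTheory GRing.Theory Num.Theory.
Import numFieldNormedType.Exports.
Local Open Scope classical_set_scope.
Local Open Scope ring_scope.
Set Implicit Arguments.
Unset Strict Implicit.
Unset Printing Implicit Defensive.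

(** The proof is an estimate-sequence argument, carried by the quantity
      [A_t * (f y_t - f u) + V_t u],
    where [u] is a minimizer of [f] and [V_t u] is the Bregman divergence from
    [z_t] to [u]. One iteration increases it by at most
    [A_{t+1} * (delta / 2)] ([coupling_step]). As [A_0 = 0], the
    Bregman terms are nonnegative and [V_0 u <= Psi u - Psi x0], summing the
    [T] increments, each at most [A_T * (delta / 2)], and dividing by [A_T]
    gives the bound.

    Three facts make the iteration work.
    - A Hoelder-smooth function is, up to the additive error [delta / 2],
      bounded above by its linear model plus [M / p] times the [p]-th power of
      the distance ([holder_inexact_model]): the exponent [sigma] is traded for
      [p] by Young's inequality, and the lower bound on [M] is exactly what
      makes the remainder [delta / 2]. So the step defining [y_{t+1}]
      minimizes an approximate upper model of [f].
    - A subgradient of [Psi] at any point of [Q], boundary points included,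
      enjoys the growth of order [p] that uniform convexity grants to one
      subgradient at each interior point
      ([uniformly_convex_subgradient]). So the mirror step pays for the
      movement from [z_t] to [z_{t+1}].
    - The step sizes satisfy [A_t = gamma_t ^ p / M] and [tau_t = 1 / gamma_{t+1}],
      whence [A_{t+1} * tau_t ^ p = 1 / M] ([Asum_tau_powR]): the
      price of the mirror step and the regularization of the gradient step are
      then equal.

    The subgradient at [z_T] is not part of the run. It is supplied by the
    optimality of [z_T]: since [z_T] minimizes [Psi] plus a linear form over
    [Q], the opposite of that form is a subgradient there. *)

(** * Power inequalities *)

(** The graph of a convex power lies above its tangents; this form, valid at
    [a = 0] too, is Young's inequality applied to [a `^ (s - 1) * b]. *)
Lemma powR_tangent (R : realType) (s a b : R) : 1 < s -> 0 <= a -> 0 <= b ->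
  a `^ s + s * a `^ (s - 1) * (b - a) <= b `^ s.
Proof.
move=> s1 a0 b0.
have s0 : 0 < s by lra.
have sm0 : 0 < s - 1 by lra.
have q0 : 0 < s / (s - 1) by rewrite divr_gt0.
have pq : (s / (s - 1))^-1 + s^-1 = 1 by field; rewrite !gt_eqF.
have := @conjugate_powR R (a `^ (s - 1)) b _ _ (powR_ge0 _ _) b0 q0 s0 pq.
rewrite -powRrM (_ : (s - 1) * (s / (s - 1)) = s); last by field; rewrite gt_eqF.
rewrite invf_div -(ler_pM2l s0) mulrDr => young.
have aE := mulr_powRB1 a0 s0.
have e1 : s * (a `^ s * ((s - 1) / s)) = (s - 1) * a `^ s
  by field; rewrite gt_eqF.
have e2 : s * (b `^ s / s) = b `^ s by field; rewrite gt_eqF.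
have e3 : s * a `^ (s - 1) * (b - a) = s * (a `^ (s - 1) * b) - s * a `^ s
  by rewrite -aE; ring.
rewrite e1 e2 in young; rewrite e3; lra.
Qed.

(** Young's inequality with exponents [p / sigma] and [p / (p - sigma)], applied
    to the factors [M `^ (sigma / p) * r `^ sigma] and [L / M `^ (sigma / p)]:
    the first one yields the power [r `^ p], and the bound on [M] keeps the
    power of the second one below [delta / 2]. When [p = sigma] that exponent
    degenerates, but then the bound on [M] reads [L <= M]. *)
Lemma young_tradeoff (R : realType) (p sigma L delta M r : R) :
  0 < sigma -> sigma <= p -> 0 <= L -> 0 < delta -> 0 < M -> 0 <= r ->
  (2 / p * ((p - sigma) / sigma) * (1 / delta)) `^ ((p - sigma) / sigma)
    * L `^ (p / sigma) <= M ->
  L / sigma * r `^ sigma <= M / p * r `^ p + delta / 2.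
Proof.
move=> s0; rewrite le_eqVlt => /orP[/eqP <-|sp] L0 d0 M0 r0.
  rewrite subrr mul0r powRr0 mul1r divff ?gt_eqF// powRr1// => LM.
  have : L / sigma * r `^ sigma <= M / sigma * r `^ sigma.
    by rewrite ler_wpM2r ?powR_ge0// ler_wpM2r// invr_ge0 ltW.
  lra.
set kappa := 2 / p * _ * _ => hM.
have p0 : 0 < p by lra.
have ps0 : 0 < p - sigma by lra.
have k0 : 0 < kappa by rewrite /kappa !mulr_gt0 ?invr_gt0.
have pN0 := gt_eqF p0; have sN0 := gt_eqF s0; have psN0 := gt_eqF ps0.
have B0 : 0 < M `^ (sigma / p) by rewrite powR_gt0.
have LB : kappa `^ ((p - sigma) / p) * L <= M `^ (sigma / p).
  have : (kappa `^ ((p - sigma) / sigma) * L `^ (p / sigma)) `^ (sigma / p)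
          <= M `^ (sigma / p).
    apply: ge0_ler_powR => //; rewrite ?nnegrE ?mulr_ge0 ?powR_ge0 ?invr_ge0//;
    exact: ltW.
  rewrite powRM ?powR_ge0// -!powRrM.
  rewrite (_ : p / sigma * (sigma / p) = 1) ?powRr1//; last first.
    by field; rewrite pN0 sN0.
  rewrite (_ : (p - sigma) / sigma * (sigma / p) = (p - sigma) / p)//.
  by field; rewrite pN0 sN0.
(* the hypothesis on [M] bounds the second Young factor by a power of [kappa] *)
set b := L / M `^ (sigma / p).
have b0 : 0 <= b by rewrite /b divr_ge0// ltW.
have bk : b `^ (p / (p - sigma)) <= kappa^-1.
  have : b `^ (p / (p - sigma))
        <= (kappa `^ (- ((p - sigma) / p))) `^ (p / (p - sigma)).
    apply: ge0_ler_powR => //; rewrite ?nnegrE ?powR_ge0//.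
      by rewrite divr_ge0// ltW.
    rewrite powRN /b ler_pdivrMr// mulrC ler_pdivlMr ?powR_gt0//.
    by rewrite mulrC.
  have e0 : - ((p - sigma) / p) * (p / (p - sigma)) = - 1.
    by field; rewrite pN0 psN0.
  by rewrite -powRrM e0 powR_inv1// ltW.
have q1 : 0 < p / sigma by rewrite divr_gt0.
have q2 : 0 < p / (p - sigma) by rewrite divr_gt0.
have q12 : (p / sigma)^-1 + (p / (p - sigma))^-1 = 1.
  by field; rewrite pN0 sN0 psN0.
have a0 : 0 <= M `^ (sigma / p) * r `^ sigma by rewrite mulr_ge0 ?powR_ge0.
have := conjugate_powR a0 b0 q1 q2 q12.
rewrite powRM ?powR_ge0// -!powRrM.
rewrite (_ : sigma / p * (p / sigma) = 1); last by field; rewrite pN0 sN0.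
rewrite (_ : sigma * (p / sigma) = p); last by field; rewrite sN0.
rewrite (powRr1 (ltW M0)) !invf_div => young.
have e1 : M `^ (sigma / p) * r `^ sigma * b = L * r `^ sigma.
  by rewrite /b; field; rewrite gt_eqF.
have bk' : b `^ (p / (p - sigma)) * ((p - sigma) / p)
           <= kappa^-1 * ((p - sigma) / p).
  by rewrite ler_wpM2r// divr_ge0// ltW.
have e2 : kappa^-1 * ((p - sigma) / p) = sigma * (delta / 2).
  by rewrite /kappa; field; rewrite pN0 sN0 psN0 gt_eqF.
rewrite e1 in young.
have {}young : L * r `^ sigma <= M * r `^ p * (sigma / p) + sigma * (delta / 2)
  by lra.
rewrite -(ler_pM2l s0).
have e3 : sigma * (L / sigma * r `^ sigma) = L * r `^ sigma.
  by field; rewrite sN0.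
have e4 : sigma * (M / p * r `^ p + delta / 2)
          = M * r `^ p * (sigma / p) + sigma * (delta / 2).
  by field; rewrite pN0.
by rewrite e3 e4.
Qed.

(** Passage to the limit along the parameters [1 / (k + 2)], all of which lie
    strictly between 0 and 1. *)
Lemma ge0_harmonic (R : realType) (D C : R) :
  (forall k : nat, 0 <= D + C / k.+2%:R) -> 0 <= D.
Proof.
move=> DC; rewrite leNgt; apply/negP => D0.
have [k Ck] : exists k : nat, C / (- D) < k%:R.
  by exists (Num.truncn `|C / (- D)|).+1; rewrite (le_lt_trans (ler_norm _))// truncnS_gt.
have := DC k; apply/negP; rewrite -ltNge.
have k0 : 0 < k.+2%:R :> R by rewrite ltr0n.
rewrite -subr_gt0 sub0r opprD subr_gt0 ltr_pdivrMr//.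
move: Ck; rewrite ltr_pdivrMr ?oppr_gt0// mulrC => /lt_trans; apply.
by rewrite ltr_pM2l ?oppr_gt0// ltr_nat.
Qed.

(** * Norms and dual norms on row vectors *)

Section InnerProduct.
Context {R : realType} {n : nat}.
Implicit Types (u v g : 'rV[R]_n) (a : R).

Lemma dotDr g u v : dot g (u + v) = dot g u + dot g v.
Proof. by rewrite -big_split; apply: eq_bigr => i _; rewrite mxE mulrDr. Qed.

Lemma dotZr g a v : dot g (a *: v) = a * dot g v.
Proof. by rewrite mulr_sumr; apply: eq_bigr => i _; rewrite mxE mulrCA. Qed.

Lemma dotC u v : dot u v = dot v u.
Proof. by apply: eq_bigr => i _; rewrite mulrC. Qed.

Lemma dotNr g v : dot g (- v) = - dot g v.
Proof. by rewrite -scaleN1r dotZr mulN1r. Qed.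

Lemma dotDl g u v : dot (u + v) g = dot u g + dot v g.
Proof. by rewrite !(dotC _ g) dotDr. Qed.

Lemma dotNl g v : dot (- v) g = - dot v g.
Proof. by rewrite !(dotC _ g) dotNr. Qed.

Lemma dotZl g a v : dot (a *: v) g = a * dot v g.
Proof. by rewrite !(dotC _ g) dotZr. Qed.

Lemma dot0r g : dot g 0 = 0.
Proof. by rewrite -(scale0r (0 : 'rV[R]_n)) dotZr mul0r. Qed.

Lemma coord_le_sup_norm v i : `|v 0 i| <= `|v|.
Proof.
rewrite [leRHS]/Num.norm /= mx_normrE; apply/bigmax_geP; right => /=.
by exists (0, i).
Qed.

Lemma nbhs_sup_normP u (P : set 'rV[R]_n) :
  nbhs u P <-> exists2 r : R, 0 < r & forall v, `|u - v| < r -> P v.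
Proof.
split=> [/nbhs_ballP[r r0 rP]|[r r0 rP]].
  by exists r => // v uv; apply: rP; rewrite mx_norm_ball.
by apply/nbhs_ballP; exists r => // v; rewrite mx_norm_ball; exact: rP.
Qed.

Lemma le_dot_sup_norm g v : dot g v <= (\sum_(i < n) `|g 0 i|) * `|v|.
Proof.
rewrite mulr_suml; apply: ler_sum => i _.
by rewrite (le_trans (ler_norm _))// normrM ler_wpM2l// coord_le_sup_norm.
Qed.

End InnerProduct.

Definition dotE := (@dotDl, @dotNl, @dotZl, @dotDr, @dotNr, @dotZr, @dot0r).

Section Norms.
Context {R : realType} {n : nat} {N : 'rV[R]_n -> R} (hN : is_norm N).
Implicit Types u v g : 'rV[R]_n.

Lemma norm_zero : N 0 = 0.
Proof. by rewrite -(scale0r (0 : 'rV[R]_n)) (norm_scale hN) normr0 mul0r. Qed.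

Lemma norm_opp v : N (- v) = N v.
Proof. by rewrite -scaleN1r (norm_scale hN) normrN1 mul1r. Qed.

Lemma norm_nneg v : 0 <= N v.
Proof.
have := norm_triangle hN v (- v); rewrite subrr norm_zero norm_opp; lra.
Qed.

Lemma norm_subC u v : N (u - v) = N (v - u).
Proof. by rewrite -opprB norm_opp. Qed.

Lemma norm_le_sup_norm : exists2 B, 0 <= B & forall v, N v <= B * `|v|.
Proof.
exists (\sum_(j < n) N (delta_mx 0 j)) => [|v].
  by apply: sumr_ge0 => j _; exact: norm_nneg.
rewrite {1}(row_sum_delta v) mulr_suml.
elim/big_ind2: _ => [|x1 x2 y1 y2 h1 h2|j _]; first by rewrite norm_zero.
  exact: le_trans (norm_triangle hN _ _) (lerD h1 h2).
by rewrite (norm_scale hN) mulrC ler_wpM2l ?norm_nneg// coord_le_sup_norm.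
Qed.

Lemma vector_norm_continuous : continuous N.
Proof.
have [B B0 hB] := norm_le_sup_norm => u.
apply/(@cvgrPdist_lt _ _ _ (nbhs u) (nbhs_filter u)) => e e0.
have d0 : 0 < e / (B + 1) by rewrite divr_gt0// ltr_wpDl.
apply/nbhs_sup_normP; exists (e / (B + 1)) => //= v uv.
have h1 := norm_triangle hN (u - v) v; rewrite subrK in h1.
have h2 := norm_triangle hN (v - u) u; rewrite subrK norm_subC in h2.
have h3 := hB (u - v).
have h4 : B * `|u - v| < e.
  move: uv; rewrite ltr_pdivlMr ?ltr_wpDl// => uv.
  have := normr_ge0 (u - v); lra.
by rewrite ltr_norml; apply/andP; split; lra.
Qed.

(** Equivalence of norms: [N] attains a positive minimum on the compact unit
    sphere of the sup norm. *)
Lemma sup_norm_le_norm : exists2 C, 0 <= C & forall v, `|v| <= C * N v.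
Proof.
pose S := [set v : 'rV[R]_n | `|v| = 1].
have onS v : v != 0 -> S (`|v|^-1 *: v).
  move=> v0; rewrite /S/= normrZ normfV normr_id mulVf//.
  by rewrite normr_eq0.
have [[w Sw]|S0] := pselect (S !=set0); last first.
  exists 0 => // v; have [->|v0] := eqVneq v 0; first by rewrite normr0 mul0r.
  by exfalso; apply: S0; exists (`|v|^-1 *: v); exact: onS.
have cS : compact S.
  apply: bounded_closed_compact.
    by exists 1; split => // M M1 v /= ->; exact: ltW.
  have -> : S = (fun v : 'rV[R]_n => `|v|) @^-1` [set x | x = 1] by [].
  apply: closed_comp => [v _|]; first exact: norm_continuous.
  exact: closed_eq.
have [|c cS' cmin] := EVT_min_rV (ex_intro _ w Sw) cS (f := N).
  exact: continuous_subspaceT vector_norm_continuous.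
rewrite inE in cS'.
have c0 : 0 < N c.
  rewrite lt0r norm_nneg andbT; apply/eqP => /(norm_definite hN) c0.
  by move: cS'; rewrite /S/= c0 normr0 => /eqP; rewrite eq_sym oner_eq0.
exists (N c)^-1 => [|v]; first by rewrite invr_ge0 ltW.
have [->|v0] := eqVneq v 0; first by rewrite normr0 norm_zero mulr0.
have := cmin _ (mem_set (onS v v0)).
rewrite (norm_scale hN) normfV normr_id mulrC ler_pdivlMr ?normr_gt0// => cv.
by rewrite mulrC ler_pdivlMr// mulrC.
Qed.

(** Without this bound the supremum defining the dual norm would be a junk
    value and the duality inequality below could fail. *)
Lemma dual_norm_ubound g : has_ubound [set dot g v | v in [set v | N v <= 1]].
Proof.
have [C C0 hC] := sup_norm_le_norm.
exists ((\sum_(i < n) `|g 0 i|) * C) => _ [v /= v1 <-].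
apply: le_trans (le_dot_sup_norm g v) _.
rewrite ler_wpM2l ?sumr_ge0//.
by rewrite (le_trans (hC v))// -[leRHS]mulr1 ler_wpM2l.
Qed.

Lemma dual_norm_nneg g : 0 <= dual_norm N g.
Proof.
apply: ub_le_sup; first exact: dual_norm_ubound.
by exists 0; rewrite ?dot0r//= norm_zero.
Qed.

Lemma dot_le_dual_norm g v : dot g v <= dual_norm N g * N v.
Proof.
have [->|v0] := eqVneq v 0; first by rewrite dot0r norm_zero mulr0.
have Nv0 : 0 < N v.
  rewrite lt0r norm_nneg andbT; exact: contra_neq (@norm_definite _ _ _ hN v) v0.
rewrite -ler_pdivrMr// mulrC -dotZr.
apply: ub_le_sup; first exact: dual_norm_ubound.
exists ((N v)^-1 *: v) => //=.
by rewrite (norm_scale hN) ger0_norm ?mulVf ?gt_eqF// invr_ge0 ltW.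
Qed.

End Norms.

(** * Convexity, smoothness and uniform convexity on a convex set *)

Section Convexity.
Context {R : realType} {n : nat}.
Implicit Types (Q : set 'rV[R]_n) (u v x y z g s : 'rV[R]_n).
Implicit Types (f Psi : 'rV[R]_n -> R).

Lemma convex_set_comb Q a b (t : R) : convex_set Q -> Q a -> Q b ->
  0 <= t -> t <= 1 -> Q ((1 - t) *: a + t *: b).
Proof.
move=> cQ Qa Qb t0 t1.
have /set_mem := cQ b a (Itv01 t0 t1) (mem_set Qb) (mem_set Qa).
by rewrite addrC.
Qed.

Lemma convex_function_comb Q f a b (t : R) : convex_function Q f ->
  Q a -> Q b -> 0 <= t -> t <= 1 ->
  f ((1 - t) *: a + t *: b) <= (1 - t) * f a + t * f b.
Proof.
move=> cf Qa Qb t0 t1.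
have := cf (Itv01 t0 t1) b a (mem_set Qb) (mem_set Qa).
by rewrite [(1 - t) *: a + _]addrC [(1 - t) * f a + _]addrC.
Qed.

(** A small displacement of the combination can be charged entirely to the
    endpoint [b], where it is magnified by [t^-1] but stays in [Q]. *)
Lemma interior_comb Q a b (t : R) : convex_set Q -> Q a -> interior Q b ->
  0 < t -> t <= 1 -> interior Q ((1 - t) *: a + t *: b).
Proof.
move=> cQ Qa /nbhs_sup_normP[r r0 rQ] t0 t1.
apply/nbhs_sup_normP; exists (t * r); first by rewrite mulr_gt0.
move=> v; set w := (1 - t) *: a + t *: b => wv.
have -> : v = (1 - t) *: a + t *: (b + t^-1 *: (v - w)).
  rewrite scalerDr scalerA divff ?gt_eqF// scale1r addrA -/w.
  by rewrite addrCA subrr addr0.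
apply: convex_set_comb => //; last exact: ltW.
apply: rQ; rewrite opprD addrA subrr sub0r -scalerN opprB normrZ.
by rewrite ger0_norm ?invr_ge0 ?ltW// mulrC ltr_pdivrMr// mulrC.
Qed.

(** Along the segment from [x] to [y], convexity bounds the increase of [f] by
    the chord, and differentiability compares it with the slope at [x]. All the
    points used are in [Q], so a gradient relative to [Q] suffices. *)
Lemma gradient_is_subgradient Q f gradf x : convex_set Q ->
  convex_function Q f -> is_gradient_on Q f gradf -> Q x ->
  is_subgradient Q f x (gradf x).
Proof.
move=> cQ cf gf Qx y Qy; set d := y - x.
apply/ler_addgt0Pr => e e0.
have nd1 : 0 < `|d| + 1 by rewrite ltr_wpDl.
have /nbhs_sup_normP[r r0 hr] := gf x Qx (e / (`|d| + 1)) (divr_gt0 e0 nd1).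
(* a point of the segment that is within distance [r] of [x] *)
pose t := Num.min 1 (r / 2 / (`|d| + 1)).
have t0 : 0 < t by rewrite /t lt_min ltr01 !divr_gt0.
have t1 : t <= 1 by rewrite /t ge_min lexx.
have tr : t * `|d| < r.
  have : t <= r / 2 / (`|d| + 1) by rewrite /t ge_min lexx orbT.
  rewrite ler_pdivlMr// => h; have := normr_ge0 d; lra.
have := convex_function_comb cf Qx Qy (ltW t0) t1.
have Qv := convex_set_comb cQ Qx Qy (ltW t0) t1.
set v := (1 - t) *: x + t *: y in Qv *.
have vx : v - x = t *: d.
  by apply/rowP => i; rewrite !mxE; ring.
have := hr v; rewrite /= -opprB vx normrN normrZ (gtr0_norm t0) dotZr.
move=> /(_ tr Qv); rewrite ler_norml => /andP[hv _] fv.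
have : t * (f x + dot (gradf x) d) <= t * (f y + e).
  have : e / (`|d| + 1) * (t * `|d|) <= t * e.
    rewrite mulrCA (ler_wpM2l (ltW t0))// mulrAC ler_pdivrMr//.
    by rewrite (ler_wpM2l (ltW e0))// lerDl.
  lra.
by rewrite ler_pM2l.
Qed.

(** A negative constant would contradict the nonnegativity of the dual norm as
    soon as [Q] has two points. *)
Lemma holder_const_nneg N Q (sigma L : R) (gradf : 'rV[R]_n -> 'rV[R]_n) x y :
  is_norm N -> Q x -> Q y -> x != y ->
  (forall x y, Q x -> Q y ->
     dual_norm N (gradf x - gradf y) <= L * N (x - y) `^ (sigma - 1)) ->
  0 <= L.
Proof.
move=> hN Qx Qy xy hL; rewrite leNgt; apply/negP => L0.
have := hL x y Qx Qy; rewrite leNgt => /negP; apply.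
apply: lt_le_trans (dual_norm_nneg hN _).
rewrite nmulr_rlt0// powR_gt0// lt0r norm_nneg// andbT.
apply: contra_neq xy => /(norm_definite hN)/eqP; rewrite subr_eq0; exact: eqP.
Qed.

(** Integration of the gradient along the segment from [x] to [y], carried out
    on uniform partitions. On a cell the subgradient inequality at its right end
    and [powR_tangent] bound the excess of [f] over the claimed model by
    [K / m] times the increment of [t `^ (sigma - 1)]; these increments
    telescope, so that the total excess is at most [K / m] for all [m]. *)
Lemma holder_smooth N Q (sigma L : R) f (gradf : 'rV[R]_n -> 'rV[R]_n) x y :
  is_norm N -> convex_set Q -> 1 < sigma -> 0 <= L ->
  (forall x, Q x -> is_subgradient Q f x (gradf x)) ->
  (forall x y, Q x -> Q y ->
     dual_norm N (gradf x - gradf y) <= L * N (x - y) `^ (sigma - 1)) ->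
  Q x -> Q y ->
  f y <= f x + dot (gradf x) (y - x) + L / sigma * N (y - x) `^ sigma.
Proof.
move=> hN cQ s1 L0 sub hL Qx Qy; set d := y - x.
have s0 : 0 < sigma by lra.
pose K := L * N d `^ sigma.
have K0 : 0 <= K by rewrite mulr_ge0 ?powR_ge0.
pose pt (t : R) := x + t *: d.
have ptE t : pt t = (1 - t) *: x + t *: y.
  by apply/rowP => i; rewrite !mxE; ring.
have Qpt t : 0 <= t -> t <= 1 -> Q (pt t).
  by move=> t0 t1; rewrite ptE; exact: convex_set_comb.
pose H t := f (pt t) - t * dot (gradf x) d - K / sigma * t `^ sigma.
have stepH a b : 0 <= a -> a <= b -> b <= 1 ->
    H b - H a <= K * (b - a) * (b `^ (sigma - 1) - a `^ (sigma - 1)).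
  move=> a0 ab b1; have b0 := le_trans a0 ab.
  have Qa := Qpt a a0 (le_trans ab b1); have Qb := Qpt b b0 b1.
  have fab : f (pt b) - f (pt a) <= (b - a) * dot (gradf (pt b)) d.
    have := sub _ Qb _ Qa.
    rewrite (_ : pt a - pt b = (a - b) *: d) ?dotZr; first lra.
    by rewrite /pt opprD addrACA subrr add0r -scalerBl.
  have gb : dot (gradf (pt b)) d <= dot (gradf x) d + K * b `^ (sigma - 1).
    have := dot_le_dual_norm hN (gradf (pt b) - gradf x) d.
    have := ler_wpM2r (norm_nneg hN d) (hL _ _ Qb Qx).
    rewrite (_ : pt b - x = b *: d); last by rewrite /pt addrAC subrr add0r.
    rewrite (norm_scale hN) (ger0_norm b0) powRM ?norm_nneg// !dotE /K.
    rewrite -(mulr_powRB1 (norm_nneg hN d) s0); lra.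
  have := ler_wpM2l (_ : 0 <= b - a) gb; rewrite subr_ge0 => /(_ ab) gb'.
  have := ler_wpM2l (divr_ge0 K0 (ltW s0)) (powR_tangent s1 a0 b0).
  rewrite mulrDr (_ : K / sigma * (sigma * a `^ (sigma - 1) * (b - a))
                      = K * (a `^ (sigma - 1) * (b - a))); last first.
    by field; rewrite gt_eqF.
  rewrite /H; lra.
suff : 0 <= H 0 - H 1.
  have xd : x + d = y by rewrite /d addrC subrK.
  rewrite /H powR1 powR0 ?gt_eqF// /pt scale1r scale0r addr0 xd /K; lra.
apply: (@ge0_harmonic _ _ K) => k.
set m : R := k.+2%:R; have m0 : 0 < m by rewrite ltr0n.
have part j : (j <= k.+2)%N ->
    H (j%:R / m) - H 0 <= K / m * (j%:R / m) `^ (sigma - 1).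
  elim: j => [_|j IH jk].
    by rewrite mul0r subrr powR0 ?mulr0// subr_eq0 gt_eqF.
  have := IH (ltnW jk).
  have jm0 : 0 <= j%:R / m by rewrite divr_ge0// ltW.
  have jm : j%:R / m <= j.+1%:R / m.
    by rewrite ler_pM2r ?invr_gt0// ler_nat.
  have jm1 : j.+1%:R / m <= 1 by rewrite ler_pdivrMr// mul1r ler_nat.
  have := stepH _ _ jm0 jm jm1.
  rewrite (_ : j.+1%:R / m - j%:R / m = m^-1); last first.
    by rewrite -mulrBl -natrB// subSnn mul1r.
  set A := (j%:R / m) `^ _; set B := (j.+1%:R / m) `^ _.
  set Hj := H (j%:R / m); set Hj1 := H (j.+1%:R / m); set c := m^-1.
  move: A B Hj Hj1 c => A B Hj Hj1 c; lra.
have := part k.+2 (leqnn _); rewrite divff ?gt_eqF// powR1 mulr1.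
by rewrite -subr_ge0 opprB addrC.
Qed.

(** Uniform convexity speaks of one subgradient at each interior point. To reach
    an arbitrary subgradient at an arbitrary [x] in [Q], take a point [w] on
    the segment from [x] to [y], pulled slightly towards the interior point 0.
    The growth from [w] to [y], averaged with the subgradient inequalities from
    [w] to [x] and to 0 so that the subgradient at [w] cancels, bounds [Psi w]
    from above, while [s] bounds it from below. Dividing by the distance
    parameter [l] and letting [l] tend to 0 gives the claim. Using the same [l]
    for the position of [w] on the segment and for the pull towards 0 leaves
    an error of at most [C * l]. *)
Lemma uniformly_convex_subgradient N Q Psi (p : R) x s y : is_norm N ->
  convex_set Q -> interior Q 0 -> 1 < p -> uniformly_convex N Q Psi p 1 ->
  Q x -> is_subgradient Q Psi x s -> Q y ->
  Psi x + dot s (y - x) + p^-1 * N (y - x) `^ p <= Psi y.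
Proof.
move=> hN cQ Q0 p1 ucPsi Qx sx Qy.
have p0 : 0 < p by lra.
set a := N (y - x).
have a0 : 0 <= a := norm_nneg hN _.
rewrite -subr_ge0.
pose C := - Psi y + Psi 0 + dot s y + p^-1 * a `^ p
          + a `^ (p - 1) * (a + N y).
apply: (@ge0_harmonic _ _ C) => k; set l : R := k.+2%:R^-1.
have l0 : 0 < l by rewrite invr_gt0 ltr0n.
have l1 : l < 1 by rewrite invf_lt1 ?ltr0n// ltr1n.
have l2 : 0 <= 1 - l by lra.
have Qy' := interior_comb cQ Qy Q0 l0 (ltW l1).
have := interior_comb cQ Qx Qy' l0 (ltW l1).
set w := (1 - l) *: x + l *: ((1 - l) *: y + l *: 0) => Qw.
have wE : w = (1 - l) *: x + (l * (1 - l)) *: y.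
  by rewrite /w scaler0 addr0 scalerA.
have [g _ hg] := ucPsi w Qw.
have Ix := hg x Qx; have Iy := hg y Qy.
have I0 := hg 0 (interior_subset Q0).
have Is := sx w (interior_subset Qw).
set b := N (y - w) in Iy.
have b0 : 0 <= b := norm_nneg hN _.
have ab : - l * (a + N y) <= b - a.
  have := norm_triangle hN (y - w) (- (l ^+ 2 *: y)).
  rewrite (norm_opp hN) (_ : y - w - _ = (1 - l) *: (y - x)); last first.
    by rewrite wE; apply/rowP => i; rewrite !mxE; ring.
  rewrite !(norm_scale hN) (ger0_norm l2) (ger0_norm (sqr_ge0 l)) -/a -/b.
  have : l ^+ 2 * N y <= l * N y.
    by rewrite ler_wpM2r ?(norm_nneg hN)// expr2 ger_pMr// ltW.
  lra.
have tang := powR_tangent p1 a0 b0.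
have tang' : p^-1 * a `^ p - l * (a `^ (p - 1) * (a + N y)) <= p^-1 * b `^ p.
  have pV0 : 0 <= p^-1 by rewrite invr_ge0 ltW.
  have := ler_wpM2l pV0 tang.
  have := ler_wpM2l (powR_ge0 a (p - 1)) ab.
  rewrite [p^-1 * (_ + _)]mulrDr (_ : p^-1 * (p * a `^ (p - 1) * (b - a))
                      = a `^ (p - 1) * (b - a)); last first.
    by field; rewrite gt_eqF.
  clear; lra.
have P0 : 0 <= a `^ (p - 1) * (a + N y).
  by rewrite mulr_ge0 ?powR_ge0// addr_ge0// norm_nneg.
rewrite div1r in Ix Iy I0.
have pw z : 0 <= p^-1 * N z `^ p.
  by rewrite mulr_ge0 ?powR_ge0// invr_ge0 ltW.
have {}Ix : Psi w + dot g (x - w) <= Psi x by apply: le_trans Ix; rewrite lerDl.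
have {}I0 : Psi w + dot g (0 - w) <= Psi 0 by apply: le_trans I0; rewrite lerDl.
rewrite wE !dotE in Ix Iy I0 Is; rewrite -wE in Ix Iy I0 Is.
have Jx := ler_wpM2l l2 Ix.
have Jy := ler_wpM2l (mulr_ge0 (ltW l0) l2) Iy.
have J0 := ler_wpM2l (sqr_ge0 l) I0.
have Jt := ler_wpM2l (mulr_ge0 (ltW l0) l2) tang'.
have Jp := mulr_ge0 (mulr_ge0 (ltW l0) (sqr_ge0 l)) P0.
suff : 0 <= l * (Psi y - (Psi x + dot s (y - x) + p^-1 * a `^ p) + C * l).
  by rewrite pmulr_rge0.
rewrite /C !dotE; clear -Jx Jy J0 Is Jt Jp; lra.
Qed.

End Convexity.

(** * One iteration of the method *)

Section OneStep.
Context {R : realType} {n : nat}.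
Implicit Types (Q : set 'rV[R]_n) (u v x y z g s : 'rV[R]_n).
Implicit Types (f Psi : 'rV[R]_n -> R).

(** The trade of exponents needs [0 <= L], which [holder_const_nneg] provides
    for two distinct points; at [y = x] the model is exact. *)
Lemma holder_inexact_model N Q (p sigma L delta M : R) f gradf x y :
  is_norm N -> convex_set Q -> 1 < sigma -> sigma <= p -> 0 < delta -> 0 < M ->
  (2 / p * ((p - sigma) / sigma) * (1 / delta)) `^ ((p - sigma) / sigma)
    * L `^ (p / sigma) <= M ->
  holder_class N Q sigma L f gradf -> Q x -> Q y ->
  f y <= f x + dot (gradf x) (y - x) + M / p * N (y - x) `^ p + delta / 2.
Proof.
move=> hN cQ s1 sp d0 M0 hM [cf gf hL] Qx Qy.
have s0 : 0 < sigma by lra.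
have p0 : 0 < p by lra.
have [->|yx] := eqVneq y x.
  by rewrite subrr dot0r norm_zero// powR0 ?gt_eqF// mulr0 !addr0 lerDl divr_ge0// ltW.
have L0 := holder_const_nneg hN Qy Qx yx hL.
have sub v (Qv : Q v) := gradient_is_subgradient cQ cf gf Qv.
have := holder_smooth hN cQ s1 L0 sub hL Qx Qy.
have := young_tradeoff s0 sp L0 d0 M0 (norm_nneg hN (y - x)) hM.
lra.
Qed.

(** It turns the optimality condition of the mirror step, a sign condition on
    the left-hand side, into a telescoping difference of divergences to [u],
    less the divergence that measures the movement from [z] to [z']. *)
Lemma bregman_three_point Psi s s' z z' u :
  dot (s' - s) (u - z')
  = bregman Psi s z u - bregman Psi s' z' u - bregman Psi s z z'.
Proof. by rewrite /bregman !dotE; ring. Qed.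

(** The progress made by one iteration, with [tau * A] as step size. Replacing
    [z] by [z'] in the definition of [x] gives a competitor for [y'] at
    displacement [tau *: (z' - z)] from [x]. By [A * tau `^ p = M^-1], the
    model value at this competitor, multiplied by [A], is the linear gain of
    the mirror step plus the [p]-th power that the divergence from [z] to [z']
    absorbs. The subgradient inequalities at [x] towards [u] and [y], with
    weights [tau] and [1 - tau], turn the remaining linear terms into values
    of [f]. *)
Lemma coupling_step N Q (p M tau A delta : R) f Psi x y z g s y' z' s' u :
  is_norm N -> convex_set Q -> 0 < p -> 0 < M -> 0 < A ->
  0 <= tau -> tau <= 1 -> A * tau `^ p = M^-1 ->
  Q y -> Q z -> Q z' -> Q u ->
  x = tau *: z + (1 - tau) *: y ->
  is_subgradient Q f x g ->
  argmin_on Q (fun v => M / p * N (v - x) `^ p + dot g (v - x)) y' ->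
  f y' <= f x + dot g (y' - x) + M / p * N (y' - x) `^ p + delta / 2 ->
  p^-1 * N (z' - z) `^ p <= bregman Psi s z z' ->
  0 <= dot (s' - s + (tau * A) *: g) (u - z') ->
  A * (f y' - f u) <= (1 - tau) * A * (f y - f u) + A * (delta / 2)
                      + (bregman Psi s z u - bregman Psi s' z' u).
Proof.
move=> hN cQ p0 M0 A0 t0 t1 At Qy Qz Qz' Qu xE subx [_ ymin] model growth opt.
have pN0 : p != 0 by rewrite gt_eqF.
have MN0 : M != 0 by rewrite gt_eqF.
pose v := (1 - tau) *: y + tau *: z'.
have vx : v - x = tau *: (z' - z).
  by rewrite /v xE; apply/rowP => i; rewrite !mxE; ring.
have := ymin v (convex_set_comb cQ Qy Qz' t0 t1).
rewrite vx dotZr (norm_scale hN) (ger0_norm t0) powRM ?norm_nneg// => minv.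
have {minv} := ler_wpM2l (ltW A0) minv.
have -> : A * (M / p * (tau `^ p * N (z' - z) `^ p) + tau * dot g (z' - z))
  = p^-1 * N (z' - z) `^ p + tau * A * dot g (z' - z).
  transitivity (M / p * (A * tau `^ p) * N (z' - z) `^ p
                + tau * A * dot g (z' - z)); first by ring.
  by rewrite At; field; rewrite pN0 MN0.
move=> minv.
have {}model := ler_wpM2l (ltW A0) model.
have subu := ler_wpM2l (mulr_ge0 t0 (ltW A0)) (subx u Qu).
have t1' : 0 <= 1 - tau by lra.
have suby := ler_wpM2l (mulr_ge0 t1' (ltW A0)) (subx y Qy).
have gx : dot g x = tau * dot g z + (1 - tau) * dot g y by rewrite xE !dotE.
have three := bregman_three_point Psi s s' z z' u.
rewrite dotDl three dotZl in opt.
rewrite [dot g (_ - _)]dotDr dotNr in opt.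
rewrite !dotDr !dotNr gx in model minv subu suby.
set V1 := bregman Psi s z u in opt *; set V2 := bregman Psi s' z' u in opt *.
set V3 := bregman Psi s z z' in opt growth.
set Y := N (y' - x) `^ p in model minv; set Z := N (z' - z) `^ p in minv growth.
move: Y Z V1 V2 V3 growth opt minv model subu suby.
move: (dot g z) (dot g z') (dot g y) (dot g u) (dot g y') (f x) (f y) (f u) (f y').
clear; intros; lra.
Qed.

End OneStep.

(** * Step sizes *)

Section StepSizes.
Context {R : realType} (p M : R) (gamma : nat -> R).
Hypotheses (hp : 1 < p) (hM : 0 < M) (hgamma : step_sequence p gamma).

Let p_gt0 : 0 < p := lt_trans ltr01 hp.

Lemma step_sequence_gt0 t : 0 < gamma t.+1.
Proof.
have [g1 gS] := hgamma.
elim: t => [|t IH]; first by rewrite g1.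
have [[g0 gE] _] := gS t.+1 isT.
rewrite lt0r g0 andbT; apply/eqP => gz; move: gE.
have p0 : p != 0 by rewrite gt_eqF.
have p10 : p - 1 != 0 by rewrite gt_eqF// subr_gt0.
by rewrite gz !powR0// add0r => /eqP; rewrite lt_eqF// powR_gt0.
Qed.

Lemma AsumS t : Asum p M gamma t.+1 = Asum p M gamma t + alpha p M gamma t.+1.
Proof. by rewrite /Asum big_ord_recr. Qed.

Lemma Asum0 : Asum p M gamma 0 = 0.
Proof. by rewrite /Asum big_ord0. Qed.

Lemma alpha_ge0 t : 0 <= alpha p M gamma t.
Proof. by rewrite divr_ge0 ?powR_ge0// ltW. Qed.

Lemma Asum_ge0 t : 0 <= Asum p M gamma t.
Proof. by apply: sumr_ge0 => i _; exact: alpha_ge0. Qed.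

(** The recursion [gamma_{t+1} `^ p - gamma_t `^ p = gamma_{t+1} `^ (p - 1)]
    makes the sum of the step sizes telescope. *)
Lemma AsumE t : Asum p M gamma t.+1 = gamma t.+1 `^ p / M.
Proof.
have [g1 gS] := hgamma.
elim: t => [|t IH]; first by rewrite AsumS Asum0 add0r /alpha g1 !powR1.
have [[_ gE] _] := gS t.+1 isT.
by rewrite AsumS IH gE /alpha -mulrDl addrC.
Qed.

Lemma Asum_gt0 t : 0 < Asum p M gamma t.+1.
Proof. by rewrite AsumE divr_gt0// powR_gt0// step_sequence_gt0. Qed.

Lemma tau_Asum t :
  tau p M gamma t * Asum p M gamma t.+1 = alpha p M gamma t.+1.
Proof. by rewrite /tau divfK// gt_eqF// Asum_gt0. Qed.

Lemma onem_tau_Asum t :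
  (1 - tau p M gamma t) * Asum p M gamma t.+1 = Asum p M gamma t.
Proof. by rewrite mulrBl mul1r tau_Asum AsumS addrK. Qed.

Lemma tau_ge0 t : 0 <= tau p M gamma t.
Proof. by rewrite divr_ge0 ?alpha_ge0// ltW// Asum_gt0. Qed.

Lemma tau_le1 t : tau p M gamma t <= 1.
Proof.
by rewrite ler_pdivrMr ?Asum_gt0// mul1r AsumS lerDr Asum_ge0.
Qed.

Lemma Asum_tau_powR t : Asum p M gamma t.+1 * tau p M gamma t `^ p = M^-1.
Proof.
have g0 := step_sequence_gt0 t.
have tauE : tau p M gamma t = (gamma t.+1)^-1.
  rewrite /tau AsumE /alpha -(mulr_powRB1 (ltW g0) p_gt0).
  by field; rewrite !gt_eqF// powR_gt0.
rewrite AsumE tauE mulrAC -powRM ?invr_ge0 ?(ltW g0)//.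
by rewrite divff ?gt_eqF// powR1 mul1r.
Qed.

End StepSizes.

(** * Convergence of the method *)

Lemma le_const_variation (R : realType) (n : nat) (Q : set 'rV[R]_n)
    (Psi : 'rV[R]_n -> R) u v : Q u -> Q v ->
  ((Psi u - Psi v)%:E <= const_variation Q Psi)%E.
Proof.
move=> Qu Qv; rewrite EFinB; apply: leeB.
  by apply: ereal_sup_ubound; exists u.
by apply: ereal_inf_lbound; exists v.
Qed.

Theorem proposition4p9 (R : realType) (n : nat) (p sigma L : R)
  (hp : 2 <= p) (hsigma : 1 < sigma) (hsigma2 : sigma <= 2)
  (Q : set 'rV[R]_n) (hQcompact : compact Q) (hQconvex : convex_set Q)
  (hQ0 : interior Q 0)
  (N : 'rV[R]_n -> R) (hN : is_norm N)
  (f : 'rV[R]_n -> R) (gradf : 'rV[R]_n -> 'rV[R]_n)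
  (hf : holder_class N Q sigma L f gradf)
  (Psi : 'rV[R]_n -> R) (hPsi : uniformly_convex N Q Psi p 1)
  (gamma : nat -> R) (hgamma : step_sequence p gamma)
  (eps delta M : R) (T : nat) (heps : 0 < eps) (hT : (0 < T)%N)
  (hdelta : delta = eps / T%:R) (hM0 : 0 < M)
  (hM : (2 / p * ((p - sigma) / sigma) * (1 / delta)) `^ ((p - sigma) / sigma)
          * L `^ (p / sigma) <= M)
  (x0 : 'rV[R]_n) (x y z s : nat -> 'rV[R]_n)
  (hx0 : prox_center Q Psi x0 (s 0%N))
  (hrun : accelerated_run N Q gradf Psi p M gamma T x0 x y z s)
  (ystar : 'rV[R]_n) (hystar : argmin_on Q f ystar) :
  ((f (y T) - f ystar)%:E
    <= const_variation Q Psi * ((Asum p M gamma T)^-1)%:E + (eps / 2)%:E)%E.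
Proof.
have p0 : 0 < p by lra.
have p1 : 1 < p by lra.
have d0 : 0 < delta by rewrite hdelta divr_gt0// ltr0n.
have sp : sigma <= p by lra.
have [cf gf hL] := hf.
have [[Qx0 x0min] s0opt] := hx0.
have [y0 z0 hx hy hz hs hsopt] := hrun.
have Qu := hystar.1.
set u := ystar in Qu *.
set A := Asum p M gamma.
set tau := tau p M gamma.
have t0 t : 0 <= tau t by exact: tau_ge0.
have t1 t : tau t <= 1 by exact: tau_le1.
have Qyz t : (t <= T)%N -> Q (y t) /\ Q (z t).
  case: t => [_|t tT]; first by rewrite y0 z0.
  by split; [exact: (hy t tT).1 | exact: (hz t tT).1].
have Qx t : (t < T)%N -> Q (x t.+1).
  move=> tT; have [Qy Qz] := Qyz t (ltnW tT).
  by rewrite hx// addrC; exact: convex_set_comb.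
(* [s'] is left free: the last iteration uses it with a subgradient that is
   not a term of the sequence [s] *)
have step t s' : (t < T)%N ->
    0 <= dot (s' - s t + alpha p M gamma t.+1 *: gradf (x t.+1)) (u - z t.+1) ->
    A t.+1 * (f (y t.+1) - f u)
    <= A t * (f (y t) - f u) + A t.+1 * (delta / 2)
       + (bregman Psi (s t) (z t) u - bregman Psi s' (z t.+1) u).
  move=> tT opt; have [Qy Qz] := Qyz t (ltnW tT); have [Qy' Qz'] := Qyz t.+1 tT.
  have growth : p^-1 * N (z t.+1 - z t) `^ p
                <= bregman Psi (s t) (z t) (z t.+1).
    have := uniformly_convex_subgradient hN hQconvex hQ0 p1 hPsi Qz (hs t tT) Qz'.
    rewrite /bregman; lra.
  rewrite -(tau_Asum p1 hM0 hgamma) in opt.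
  have := coupling_step hN hQconvex p0 hM0 (Asum_gt0 p1 hM0 hgamma t) (t0 t)
    (t1 t) (Asum_tau_powR p1 hM0 hgamma t) Qy Qz Qz' Qu (hx t tT)
    (gradient_is_subgradient hQconvex cf gf (Qx t tT)) (hy t tT)
    (holder_inexact_model hN hQconvex hsigma sp d0 hM0 hM hf (Qx t tT) Qy')
    growth opt.
  by rewrite (onem_tau_Asum p1 hM0 hgamma).
have Amono t : A t <= A t.+1 by rewrite /A AsumS lerDl alpha_ge0.
have A0 t : 0 <= A t by exact: Asum_ge0.
have err t : t%:R * A t * (delta / 2) + A t.+1 * (delta / 2)
             <= t.+1%:R * A t.+1 * (delta / 2).
  rewrite -mulrDl ler_wpM2r ?divr_ge0 ?(ltW d0)//.
  by rewrite -natr1 mulrDl mul1r lerD2r ler_wpM2l.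
have potential t : (t < T)%N ->
    A t * (f (y t) - f u) + bregman Psi (s t) (z t) u
    <= bregman Psi (s 0%N) x0 u + t%:R * A t * (delta / 2).
  elim: t => [_|t IH tT]; first by rewrite /A Asum0 z0 !mul0r add0r addr0.
  have := step t (s t.+1) (ltnW tT) (hsopt t tT u Qu).
  have := IH (ltnW tT); have := err t; lra.
have final : A T * (f (y T) - f u)
    <= bregman Psi (s 0%N) x0 u + T%:R * A T * (delta / 2).
  pose t := T.-1; have TE : t.+1 = T by rewrite prednK.
  have tT : (t < T)%N by rewrite -TE.
  set al := alpha p M gamma t.+1.
  (* the prox step makes [s t - al *: gradf (x t.+1)] a subgradient at
     [z t.+1], which serves as the missing last subgradient *)
  set s' := s t - al *: gradf (x t.+1).
  have := step t s' tT; rewrite -/al /s' addrAC subrK subrr dotC dot0r.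
  move=> /(_ (lexx _)).
  have : 0 <= bregman Psi s' (z t.+1) u.
    have := (hz t tT).2 u Qu.
    rewrite /bregman /s' !dotE -/al; lra.
  have := potential t tT; have := err t; rewrite -TE; lra.
have AT : 0 < A T by rewrite -(prednK hT); exact: Asum_gt0.
have V0 : bregman Psi (s 0%N) x0 u <= Psi u - Psi x0.
  have := s0opt u Qu; rewrite /bregman; lra.
have TN : T%:R != 0 :> R by rewrite pnatr_eq0 -lt0n.
have {}final : f (y T) - f u <= (Psi u - Psi x0) * (A T)^-1 + eps / 2.
  rewrite -(ler_pM2l AT); apply: le_trans final _.
  have -> : A T * ((Psi u - Psi x0) * (A T)^-1 + eps / 2)
            = Psi u - Psi x0 + T%:R * A T * (delta / 2).
    by rewrite hdelta; field; rewrite TN gt_eqF.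
  by rewrite lerD2r.
apply: (@le_trans _ _ ((Psi u - Psi x0) * (A T)^-1 + eps / 2)%:E).
  by rewrite lee_fin.
rewrite EFinD leeD2r// EFinM lee_pmul2r// ?lte_fin ?invr_gt0//.
exact: le_const_variation.
Qed.
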